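(* Let $n>1$ be an integer, let $A_1,\ldots,A_n$ be finite nonempty subsets of a field $F$, and let $S_{ij}$ $(1\leqslant i\neq j\leqslant n)$ be subsets of $F$ with $|S_{ij}|\leqslant (|A_i|-1)/(n-1)$. Then, for any $a_1,\ldots,a_n\in F^*$, we have $$\bigl|\{a_1x_1+\cdots+a_nx_n:\ x_1\in A_1,\ldots,x_n\in A_n,\ \text{and}\ x_i-x_j\notin S_{ij}\ \text{if}\ i\neq j\}\bigr|$$ $$\geqslant\min\left\{p(F)-(n-1)\sum_{i=1}^n m_i,\ \sum_{i=1}^n(|A_i|-1)-2(n-1)\sum_{i=1}^n m_i+1\right\},$$ where $m_i=\max_{j\in\{1,\ldots,n\}\setminus\{i\}}|S_{ij}|$ for $i=1,\ldots,n$.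
   Context: $F^*=F\setminus\{0\}$. $p(F)$ denotes the additive order of the multiplicative identity of $F$: it equals the characteristic of $F$ if this is a prime, and $p(F)=+\infty$ if $F$ has characteristic zero (in which case $\min\{p(F)-c,\,x\}=x$ for integers $c,x$). *)

(* Defs.v *)
From mathcomp Require Import all_boot all_order all_algebra finmap.
From mathcomp Require Import boolp constructive_ereal.

Set Implicit Arguments.
Unset Strict Implicit.
Unset Printing Implicit Defensive.

Import Order.TTheory GRing.Theory Num.Theory.

Local Open Scope ring_scope.
Local Open Scope fset_scope.

(* The additive order of 1 is an extended integer, +oo in characteristic 0,   *)
(* so that differences and minima below are those of [\bar int].              *)
Definition one_order (F : fieldType) : \bar int :=
  match pselect (exists k : nat, (0 < k)%N && (k%:R == 0 :> F)) with
  | left ex_k => ((ex_minn ex_k)%:Z)%:E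
  | right _ => +oo%E
  end.

Definition restricted_sumset (F : fieldType) (n : nat) (a : 'I_n -> F)
    (A : 'I_n -> {fset F}) (S : 'I_n -> 'I_n -> {fset F}) : {fset F} :=
  [fset y in [seq \sum_(i < n) a i * fsval (x i)
             | x : {dffun forall i : 'I_n, A i} in
                 [pred x : {dffun forall i : 'I_n, A i} |
                   [forall i, forall j,
                     (i != j) ==> (fsval (x i) - fsval (x j) \notin S i j)]]]].

Definition max_excluded (F : fieldType) (n : nat) (S : 'I_n -> 'I_n -> {fset F})
    (i : 'I_n) : nat :=
  (\max_(j < n | j != i) #|` S i j|)%N.

Lemma one_order_pchar (F : fieldType) (p : nat) :
  p \in [pchar F] -> one_order F = (p%:Z)%:E.
Proof.
move=> pF; rewrite /one_order; case: pselect => [ex_k|[]].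
  case: ex_minnP => k /andP[k_gt0 k0] kmin; congr (_%:Z%:E).
  apply/eqP; rewrite eqn_leq kmin ?(prime_gt0 (pcharf_prime pF)) ?pcharf0 ?eqxx//.
  by rewrite dvdn_leq // (dvdn_pcharf pF).
by exists p; rewrite (prime_gt0 (pcharf_prime pF)) pcharf0 ?eqxx.
Qed.

Lemma one_order_pchar0 (F : fieldType) :
  [pchar F] =i pred0 -> one_order F = +oo%E.
Proof.
move=> /pcharf0P F0; rewrite /one_order; case: pselect => // ex_k.
by case: ex_minnP => k; rewrite F0; case: k.
Qed.

Lemma restricted_sumsetP (F : fieldType) (n : nat) (a : 'I_n -> F)
    (A : 'I_n -> {fset F}) (S : 'I_n -> 'I_n -> {fset F}) (y : F) :
  reflect (exists x : 'I_n -> F,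
            [/\ forall i, x i \in A i,
                forall i j, i != j -> x i - x j \notin S i j
              & y = \sum_(i < n) a i * x i])
          (y \in restricted_sumset a A S).
Proof.
rewrite /restricted_sumset in_fset.
apply: (iffP imageP) => /= [[x xS ->]|[x [xA xS ->]]].
  exists (fun i => fsval (x i)); split=> // i j ij.
  by move: xS; rewrite inE => /forallP/(_ i)/forallP/(_ j)/implyP/(_ ij).
exists [ffun i => [` xA i]] => /=.
  by rewrite inE; apply/forallP=> i; apply/forallP=> j; apply/implyP=> /xS;
    rewrite !ffunE.
by apply: eq_bigr => i _; rewrite ffunE.
Qed.

(* Main.v *)
Require Import Defs.
From mathcomp Require Import all_boot all_order all_algebra finmap.
From mathcomp Require mpoly.
From mathcomp Require Import ring zify.

(** The proof is an instance of the polynomial method.  Put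
    [d = (n-1) * \sum m_i], and let [P] be the product over all [i != j] of
    [(x_i - x_j)^(m_i - |S_ij|) * \prod_(y in S_ij) (x_i - x_j - y)]: it has
    degree [d], and it vanishes at every point that violates one of the
    restrictions.  The theorem follows from two facts.

    - A restricted sum bound for an arbitrary polynomial
      ([restricted_linear_sum_bound]).  Suppose that [P] has degree [d] and that
      a monomial [x^k] of degree [d], with [k_i < |A_i|], occurs in [P].  Let [C]
      contain all the values [\sum a_i x_i] with [x_i] in [A_i] and [P x != 0].
      If [|C|] is too small, then the polynomial
      [P * (\sum a_i x_i)^(N - |C|) * \prod_(y in C) (\sum a_i x_i - y)] vanishes
      on the grid [\prod A_i]; by the Combinatorial Nullstellensatz none of its
      monomials [x^b] of top degree with [b_i < |A_i|] can occur.  But its top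
      part is that of [P * (\sum a_i x_i)^N], and up to nonzero factors the
      coefficient of [x^b] there is a factorial times the value at [b] of
      [\sum_m P_m * \prod_i a_i^(-m_i) * b_i (b_i-1) ... (b_i-m_i+1)].
      This is again a polynomial of degree [d] in [b] in which [x^k] occurs, so
      a second application of the Nullstellensatz, now on the grid of integer
      points of a box with sides [k_i], gives a [b] at which it is not zero.
      Moving [b] inside that box costs at most [d] in degree, which is why [d] is
      subtracted twice.

    - Dyson's constant term identity ([dyson_mcoeff]), which evaluates the
      coefficient of [\prod x_i^((n-1) m_i)] in the top part
      [\prod_(i != j) (x_i - x_j)^(m_i)] of [P] as the multinomial coefficient
      [(\sum m_i)! / \prod m_i!].  This is not zero in the field, because
      [\sum m_i <= d], and [d] is less than the characteristic as soon as the
      bound to be proved is positive.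

    Both the Nullstellensatz and Good's proof of Dyson's identity rest on the
    same piece of Lagrange interpolation, [lagrange_lead_coef]. *)

Set Implicit Arguments.
Unset Strict Implicit.
Unset Printing Implicit Defensive.

Import Order.TTheory GRing.Theory Num.Theory.

Local Open Scope ring_scope.

Section Coefficients.
Import mpoly.

(** * Lagrange interpolation and nonvanishing on grids *)

(** Interpolating [q] at the points [x_i] and comparing leading coefficients
    writes a coefficient of [q] as a combination of its values.  Denominators are
    cleared by the product of all the differences [x_k - x_j], so that the
    identity can also be used with indeterminates for the [x_i]. *)
Lemma lagrange_lead_coef (R : idomainType) (J : finType) (B : {set J})
    (x : J -> R) (q : {poly R}) :
  {in B &, injective x} -> (size q <= #|B|)%N ->
  \sum_(i in B)
     q.[x i] * \prod_(k in B :\ i) \prod_(j in B :\ k) (x k - x j)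
  = q`_(#|B|.-1) * \prod_(k in B) \prod_(j in B :\ k) (x k - x j).
Proof.
move=> x_inj size_q.
have [B0|B_gt0] := posnP #|B|.
  move: size_q; rewrite B0 leqn0 size_poly_eq0 => /eqP->.
  by rewrite coef0 mul0r big_pred0 // => i; rewrite (cards0_eq B0) inE.
set V := \prod_(k in B) _.
pose W i := \prod_(k in B :\ i) \prod_(j in B :\ k) (x k - x j).
pose ell i := \prod_(j in B :\ i) ('X - (x j)%:P).
have size_ell i : i \in B -> size (ell i) = #|B|.
  by move=> iB; rewrite /ell -big_enum size_prod_XsubC -cardE [RHS](cardsD1 i) iB.
have VW i : i \in B -> V = (ell i).[x i] * W i.
  move=> iB; rewrite /V (big_setD1 i) //=; congr (_ * _).
  by rewrite horner_prod; apply: eq_bigr => j _; rewrite !hornerE.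
(* The interpolation formula, with its denominators cleared: both terms agree at
   each point [x_i], and their degrees are less than the number of points. *)
pose r := \sum_(i in B) (q.[x i] * W i) *: ell i - V *: q.
have r0 : r = 0.
  apply/eqP; apply/negPn/negP => r_neq0.
  have := @max_poly_roots _ _ [seq x i | i in B] r_neq0.
  rewrite size_image => H; suff: (#|B| < #|B|)%N by rewrite ltnn.
  apply: (leq_trans (H _ _)).
  - apply/allP => _ /imageP[l lB ->]; rewrite rootE /r hornerD hornerN.
    rewrite horner_sum (bigD1 l) //= big1 ?addr0 => [|i /andP[iB il]].
      by rewrite !hornerZ (VW l) //; apply/eqP; ring.
    rewrite hornerZ horner_prod (big_setD1 l) /=; last by rewrite !inE eq_sym il.
    by rewrite hornerXsubC subrr mul0r mulr0.
  - rewrite map_inj_in_uniq ?enum_uniq // => i j.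
    by rewrite !mem_enum; apply: x_inj.
  - rewrite (leq_trans (size_polyD _ _)) // geq_max size_polyN.
    rewrite (leq_trans (size_scale_leq _ _)) // andbT.
    apply: (leq_trans (size_sum _ _ _)); apply/bigmax_leqP => i iB.
    by rewrite (leq_trans (size_scale_leq _ _)) // size_ell.
have := congr1 (fun p : {poly R} => p`_#|B|.-1) r0.
rewrite /= coefD coefN coef_sum coefZ coef0 => /subr0_eq; rewrite mulrC => <-.
apply: eq_bigr => i iB; rewrite coefZ -(size_ell i iB) -[_`__]/(lead_coef _).
by rewrite [lead_coef _](monicP _) ?mulr1 // /ell -big_enum monic_prod_XsubC.
Qed.

(** The Combinatorial Nullstellensatz, with the powers [x_i^d] replaced by any
    monic polynomials [q d] of degree [d]: the tensor product over [i] of the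
    functionals of [lagrange_lead_coef] on [k_i + 1] points of [A_i] kills every
    term except that of [k], since any other term has some [m_i < k_i].  Powers
    give [combinatorial_nullstellensatz] and falling factorials
    [falling_nonvanishing]. *)
Lemma grid_nonvanishing (R : idomainType) (n : nat) (q : nat -> {poly R})
    (A : 'I_n -> seq R) (s : seq 'X_{1..n}) (c : 'X_{1..n} -> R)
    (k : 'X_{1..n}) :
    (forall d, q d \is monic) -> (forall d, size (q d) = d.+1) ->
    (forall i, uniq (A i)) -> (forall i, k i < size (A i))%N ->
    uniq s -> k \in s -> c k != 0 ->
    {in s, forall m, mdeg m <= mdeg k}%N ->
  exists2 x : 'I_n -> R, (forall i, x i \in A i)
    & \sum_(m <- s) c m * \prod_(i < n) (q (m i)).[x i] != 0.
Proof.
move=> q_monic size_q A_uniq k_lt s_uniq ks ck_neq0 s_deg.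
(* The grids are indexed by a common finite type, of which [B i] selects the
   first [k i + 1] points of [A i]. *)
pose J := 'I_(mdeg k).+1.
have k_le i : (k i < (mdeg k).+1)%N.
  by rewrite ltnS mdegE (bigD1 i) //= leq_addr.
pose B i := [set j : J | (j <= k i)%N].
pose v i (j : J) := (A i)`_j.
have cardB i : #|B i| = (k i).+1.
  rewrite cardsE cardE -(size_map val) -[RHS](size_iota 0).
  apply/perm_size/uniq_perm;
    rewrite ?iota_uniq ?(map_inj_uniq val_inj) ?enum_uniq //.
  move=> j; rewrite mem_iota add0n ltnS /=; apply/mapP/idP => [[j' + ->]|jk].
    by rewrite mem_enum.
  by exists (Ordinal (leq_ltn_trans jk (k_le i))); rewrite ?mem_enum.
have v_inj i : {in B i &, injective (v i)}.
  move=> j1 j2; rewrite !inE => j1k j2k /eqP.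
  by rewrite /v nth_uniq ?(leq_ltn_trans _ (k_lt i)) // => /eqP/val_inj.
pose V i := \prod_(l in B i) \prod_(j in B i :\ l) (v i l - v i j).
have V_neq0 i : V i != 0.
  apply/prodf_neq0 => l lB; apply/prodf_neq0 => j; rewrite !inE => /andP[jl jB].
  by rewrite subr_eq0 eq_sym (inj_in_eq (@v_inj i)) // inE.
pose W i (j : J) :=
  \prod_(l in B i :\ j) \prod_(j' in B i :\ l) (v i l - v i j').
have [/existsP[f /andP[/familyP fB f_neq0]]|/existsPn all0] := boolP
    [exists f : {ffun 'I_n -> J}, (f \in family B) &&
      (\sum_(m <- s) c m * \prod_(i < n) (q (m i)).[v i (f i)] != 0)].
  exists (fun i => v i (f i)) => // i; rewrite mem_nth //.
  by have := fB i; rewrite inE => /leq_ltn_trans->.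
(* The tensor product of the functionals, as a sum over the whole grid. *)
have : \sum_(m <- s) c m * \prod_(i < n)
          \sum_(j in B i) (q (m i)).[v i j] * W i j = 0.
  under eq_bigr => m _ do rewrite bigA_distr_big_dep /= mulr_sumr.
  rewrite exchange_big /=; apply: big1 => f fB.
  have := all0 f; rewrite fB /= negbK => /eqP f0.
  transitivity (0 * \prod_i W i (f i)); last by rewrite mul0r.
  rewrite -[in RHS]f0 mulr_suml; apply: eq_bigr => m _.
  by rewrite big_split /= mulrA.
rewrite (bigD1_seq k) //= [X in _ + X]big_seq_cond [X in _ + X]big1 ?addr0.
  move/eqP; rewrite mulf_eq0 (negPf ck_neq0) /=.
  suff -> : \prod_(i < n) \sum_(j in B i) (q (k i)).[v i j] * W i j
            = \prod_(i < n) V i.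
    by move/prodf_eq0 => [i _]; rewrite (negPf (V_neq0 i)).
  apply: eq_bigr => i _; rewrite lagrange_lead_coef ?size_q ?cardB //=.
  suff -> : (q (k i))`_(k i) = 1 by rewrite mul1r.
  by have /monicP := q_monic (k i); rewrite lead_coefE size_q.
move=> m /andP[ms mk].
(* A term of degree at most [mdeg k] other than [k] falls short of [k] in some
   variable, where the functional gives zero. *)
have [i mi_lt] : exists i, (m i < k i)%N.
  apply/existsP; apply: contraR mk => /existsPn km.
  have {km} km: (k <= m)%MM by apply/mnm_lepP => i; rewrite leqNgt km.
  have := s_deg _ ms; rewrite -(submK km) mdegD -{2}[mdeg k]add0n leq_add2r.
  by rewrite leqn0 mdeg_eq0 => /eqP->; rewrite add0m.
rewrite (bigD1 i) //= lagrange_lead_coef ?size_q ?cardB ?ltnS //=;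
  last exact: ltnW.
by rewrite nth_default ?size_q // mul0r !(mul0r, mulr0).
Qed.

(** * Coefficients of a product with a power of a linear form *)

Lemma mcoeff_mulXm (R : comNzRingType) (n : nat) (p : {mpoly R[n]})
    (k m : 'X_{1..n}) :
  (p * 'X_[k])@_m = if (k <= m)%MM then p@_(m - k) else 0.
Proof.
case: ifP => [km|/negP km]; first by rewrite -{1}(submK km) addmC mcoeffMX.
apply: memN_msupp_eq0; rewrite (perm_mem (msuppMX _ _)).
by apply/negP => /mapP[m' _ mE]; apply: km; rewrite mE lem_addr.
Qed.

Definition linear_form (R : comNzRingType) (n : nat) (a : 'I_n -> R)
  : {mpoly R[n]} := \sum_(i < n) a i *: 'X_i.

(** The multinomial theorem, multiplied by the factorials of the exponents: in
    this form it also holds when they vanish in [R]. *)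
Lemma fact_mcoeff_linear_formX (R : comNzRingType) (n : nat) (a : 'I_n -> R)
    (N : nat) (e : 'X_{1..n}) :
  mdeg e = N ->
  (\prod_(i < n) (e i)`!)%:R * (linear_form a ^+ N)@_e
  = N`!%:R * \prod_(i < n) a i ^+ e i.
Proof.
elim: N e => [|N IHN] e.
  move/eqP; rewrite mdeg_eq0 => /eqP->; rewrite expr0 mcoeff1 eqxx mul1r mulr1.
  by rewrite !big1 // => i _; rewrite mnm0E.
move=> deg_e; rewrite exprSr /linear_form mulr_sumr raddf_sum /= mulr_sumr.
transitivity (\sum_(i < n) (e i)%:R * (N`!%:R * \prod_(j < n) a j ^+ e j));
  last first.
  by rewrite -mulr_suml -natr_sum -mdegE deg_e mulrA -natrM -factS.
apply: eq_bigr => i _; rewrite -scalerAr mcoeffZ mcoeff_mulXm lep1mP.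
have [->|ei_neq0] := eqVneq (e i) 0%N; first by rewrite /= !(mulr0, mul0r).
have [e' eE] : exists e', e = (e' + U_(i))%MM.
  by exists (e - U_(i))%MM; rewrite submK // lep1mP.
have e'i : e i = (e' i).+1 by rewrite eE mnmDE mnm1E eqxx addn1.
have e'j j : j != i -> e j = e' j.
  by move=> ji; rewrite eE mnmDE mnm1E eq_sym (negPf ji) addn0.
have -> : (e - U_(i))%MM = e' by rewrite eE addmK.
have IH : (\prod_j (e' j)`!)%:R * (linear_form a ^+ N)@_e'
          = N`!%:R * \prod_j a j ^+ e' j.
  by apply: IHN; apply: succn_inj; rewrite -deg_e eE mdegD mdeg1 addn1.
have -> : (\prod_j (e j)`!)%N = (e i * \prod_j (e' j)`!)%N.
  rewrite !(bigD1 (P := predT) i) //= e'i factS mulnA; congr (_ * _)%N.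
  by apply: eq_bigr => j /e'j->.
have -> : \prod_j a j ^+ e j = a i * \prod_j a j ^+ e' j.
  rewrite !(bigD1 (P := predT) i) //= e'i exprS mulrA; congr (_ * _).
  by apply: eq_bigr => j /e'j->.
by rewrite natrM mulrACA -/(linear_form a) IH; ring.
Qed.

(** Multiplied by [\prod b_i!], the coefficient depends polynomially on [b]: the
    monomial [m] of [Q] contributes a multinomial coefficient with lower indices
    [b_i - m_i], and [b_i! / (b_i - m_i)!] is a falling factorial. *)
Lemma fact_mcoeff_mul_linear_formX (R : comNzRingType) (n : nat)
    (a : 'I_n -> R) (Q : {mpoly R[n]}) (d N : nat) (b : 'X_{1..n}) :
  Q \is d.-homog -> mdeg b = (d + N)%N ->
  (\prod_(i < n) (b i)`!)%:R * (Q * linear_form a ^+ N)@_b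
  = N`!%:R * \sum_(m <- msupp Q)
      Q@_m * \prod_(i < n) (a i ^+ (b i - m i) * (b i ^_ m i)%:R).
Proof.
move=> /dhomogP Q_homog deg_b.
rewrite {1}[Q]mpolyE mulr_suml raddf_sum /= !mulr_sumr.
apply: eq_big_seq => m /Q_homog /= deg_m.
rewrite -scalerAl mcoeffZ (mulrC 'X_[m]) mcoeff_mulXm.
rewrite mulrCA [RHS]mulrCA; congr (_ * _).
case: ifPn => [/mnm_lepP mb|/negP mb]; last first.
  have [i bm] : exists i, (b i < m i)%N.
    apply/existsP; apply: contra_notT mb => /existsPn bm.
    by apply/mnm_lepP => i; rewrite leqNgt bm.
  by rewrite mulr0 [in RHS](bigD1 i) //= ffact_small // !(mulr0, mul0r).
have -> : (\prod_i (b i)`!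
           = (\prod_i b i ^_ m i) * \prod_i ((b - m)%MM i)`!)%N.
  by rewrite -big_split; apply: eq_bigr => i _; rewrite mnmBE /= ffact_fact.
rewrite natrM -mulrA fact_mcoeff_linear_formX; last first.
  have := deg_b; rewrite -{1}(submK (m := m) (m' := b)); last exact/mnm_lepP.
  by rewrite mdegD deg_m addnC => /addnI.
rewrite mulrCA; congr (_ * _); rewrite natr_prod -big_split /=.
by apply: eq_bigr => i _; rewrite mnmBE mulrC.
Qed.

(** * Polynomials with the same part of top degree *)

Lemma msize_leP (R : nzRingType) (n d : nat) (p : {mpoly R[n]}) :
  reflect (forall m, (d <= mdeg m)%N -> p@_m = 0) (msize p <= d)%N.
Proof.
apply: (iffP idP) => [sp m dm|p0].
  by apply: memN_msupp_eq0; apply: msize_mdeg_ge; apply: leq_trans dm.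
rewrite msizeE; apply/bigmax_leqP_seq => m mp _.
by rewrite ltnNge; apply: contraL mp => /p0 pm0; rewrite mcoeff_msupp pm0 eqxx.
Qed.

(** Equality of the homogeneous parts of degree [d] of two polynomials of degree
    at most [d]; [p] or [q] may well have smaller degree. *)
Definition same_top (R : nzRingType) (n d : nat) (p q : {mpoly R[n]}) :=
  [/\ msize p <= d.+1, msize q <= d.+1 & msize (p - q) <= d]%N.

Lemma same_top_refl (R : nzRingType) (n d : nat) (p : {mpoly R[n]}) :
  (msize p <= d.+1)%N -> same_top d p p.
Proof. by move=> sp; split; rewrite // subrr mmeasure0. Qed.

Lemma same_top_mcoeff (R : nzRingType) (n d : nat) (p q : {mpoly R[n]})
    (m : 'X_{1..n}) :
  same_top d p q -> mdeg m = d -> p@_m = q@_m.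
Proof.
case=> _ _ /msize_leP pq dm; apply/subr0_eq.
by rewrite -mcoeffB pq ?dm.
Qed.

Lemma msizeM_leq (R : idomainType) (n s t : nat) (p q : {mpoly R[n]}) :
  (msize p <= s.+1 -> msize q <= t -> msize (p * q) <= s + t)%N.
Proof.
have [->|p0] := eqVneq p 0; first by rewrite mul0r mmeasure0.
have [->|q0] := eqVneq q 0; first by rewrite mulr0 mmeasure0.
by rewrite msizeM // => ps qt; move: (leq_add ps qt); case: (_ + _)%N.
Qed.

Lemma same_topM (R : idomainType) (n d e : nat) (p q p' q' : {mpoly R[n]}) :
  same_top d p q -> same_top e p' q' -> same_top (d + e) (p * p') (q * q').
Proof.
move=> [sp sq spq] [sp' sq' spq']; split.
- by rewrite -addnS msizeM_leq.
- by rewrite -addnS msizeM_leq.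
have -> : p * p' - q * q' = p * (p' - q') + q' * (p - q) by ring.
rewrite (leq_trans (mmeasureD_le _ _ _)) // geq_max msizeM_leq //=.
by rewrite addnC msizeM_leq.
Qed.

Lemma same_top_prod (R : idomainType) (n : nat) (I : Type) (r : seq I)
    (P : pred I) (d : I -> nat) (p q : I -> {mpoly R[n]}) :
  (forall i, P i -> same_top (d i) (p i) (q i)) ->
  same_top (\sum_(i <- r | P i) d i) (\prod_(i <- r | P i) p i)
           (\prod_(i <- r | P i) q i).
Proof.
move=> pq; elim/big_rec3: _ => [|i p' q' d' Pi].
  by apply: same_top_refl; rewrite msize1.
exact/same_topM/pq.
Qed.

Lemma same_topX (R : idomainType) (n d k : nat) (p q : {mpoly R[n]}) :
  same_top d p q -> same_top (k * d) (p ^+ k) (q ^+ k).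
Proof.
move=> pq; rewrite -(card_ord k) -!prodr_const -sum_nat_const.
exact: same_top_prod.
Qed.

Lemma same_top_subC (R : nzRingType) (n : nat) (p : {mpoly R[n]}) (c : R) :
  (msize p <= 2)%N -> same_top 1 (p - c%:MP) p.
Proof.
move=> sp; have sC : (msize (c%:MP : {mpoly R[n]}) <= 1)%N.
  by rewrite mmeasureC; case: (c != 0).
split=> //; last by rewrite addrAC subrr add0r mmeasureN.
rewrite (leq_trans (mmeasureD_le _ _ _)) // geq_max sp mmeasureN.
exact: leq_trans sC _.
Qed.

Lemma msize_linear_form (R : comNzRingType) (n : nat) (a : 'I_n -> R) :
  (msize (linear_form a) <= 2)%N.
Proof.
apply: (leq_trans (mmeasure_sum _ _ _ _)); apply/bigmax_leqP => i _.
by rewrite (leq_trans (mmeasureZ_le _ _ _)) // msizeX mdeg1.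
Qed.

Lemma same_top_pihomog (R : nzRingType) (n d : nat) (p : {mpoly R[n]}) :
  (msize p <= d.+1)%N -> same_top d p (pihomog mdeg d p).
Proof.
have coefE m : (pihomog mdeg d p)@_m = if mdeg m == d then p@_m else 0.
  rewrite pihomogE big_mkcond [X in if _ then X@_m else _](mpolyE p) !raddf_sum /=.
  have [md|md] := eqVneq (mdeg m) d; last first.
    apply: big1 => k _; case: eqP => [kd|_]; last by rewrite mcoeff0.
    have /negPf km : k != m by apply: contraNneq md => <-; apply/eqP.
    by rewrite mcoeffZ mcoeffX km mulr0.
  apply: eq_bigr => k _; case: eqP => // kd.
  have /negPf km : k != m by apply: contra_not_neq kd => ->.
  by rewrite mcoeff0 mcoeffZ mcoeffX km mulr0.
move=> sp; split=> //; apply/msize_leP => m dm.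
  by rewrite coefE gtn_eqF.
rewrite mcoeffB coefE; case: eqVneq => [|md]; first by rewrite subrr.
by rewrite subr0 (msize_leP _ _ sp) // ltn_neqAle eq_sym md.
Qed.

(** * A nonzero coefficient below a given exponent *)

Lemma mnm_between (n : nat) (k t : 'X_{1..n}) (D : nat) :
  (k <= t)%MM -> (mdeg k <= D <= mdeg t)%N ->
  exists c : 'X_{1..n}, [/\ (k <= c)%MM, (c <= t)%MM & mdeg c = D].
Proof.
move=> kt /andP[kD Dt]; elim: D Dt kD => [|D IHD] Dt.
  rewrite leqn0 mdeg_eq0 => /eqP k0.
  by exists 0%MM; rewrite k0 mdeg0; split=> //;
    apply/mnm_lepP => i; rewrite mnm0E.
rewrite leq_eqVlt => /orP[/eqP kD|kD]; first by exists k; rewrite lepm_refl.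
have [c [kc ct cD]] := IHD (ltnW Dt) kD.
have [i ci] : exists i, (c i < t i)%N.
  apply/existsP; apply: contraLR Dt => /existsPn tc; rewrite -leqNgt -cD.
  by rewrite !mdegE leq_sum // => i _; rewrite leqNgt tc.
exists (c + U_(i))%MM; split; last by rewrite mdegD mdeg1 cD addn1.
  exact: lepm_trans (lem_addr _ _).
apply/mnm_lepP => j; rewrite mnmDE mnm1E.
by case: eqVneq => [<-|_]; rewrite ?addn1 // addn0; apply/mnm_lepP.
Qed.

Definition falling_poly (R : nzRingType) (d : nat) : {poly R} :=
  \prod_(t < d) ('X - t%:R%:P).

Lemma falling_poly_monic (R : nzRingType) d : falling_poly R d \is monic.
Proof. exact: monic_prod_XsubC. Qed.

Lemma size_falling_poly (R : nzRingType) d : size (falling_poly R d) = d.+1.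
Proof. by rewrite size_prod_XsubC /index_enum -enumT size_enum_ord. Qed.

Lemma horner_falling_poly (R : comNzRingType) (d b : nat) :
  (falling_poly R d).[b%:R] = (b ^_ d)%:R.
Proof.
rewrite horner_prod; under eq_bigr do rewrite hornerXsubC.
have [bd|db] := ltnP b d.
  by rewrite ffact_small // (bigD1 (Ordinal bd)) //= subrr mul0r.
rewrite ffact_prod natr_prod; apply: eq_bigr => t _.
by rewrite natrB // ltnW // (leq_trans (ltn_ord t)).
Qed.

(** The sum is a polynomial in [b] in which the product of the [b_i^(k_i)] has
    coefficient [g k], and [b] ranges over the integer points of a box with
    [k_i + 1] points in direction [i]; these remain distinct in [F] because [k_i]
    is smaller than the characteristic. *)
Lemma falling_nonvanishing (F : fieldType) (n : nat) (g : 'X_{1..n} -> F)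
    (s : seq 'X_{1..n}) (k c : 'X_{1..n}) :
  (forall t, (0 < t <= mdeg k)%N -> t%:R != 0 :> F) ->
  uniq s -> k \in s -> g k != 0 -> {in s, forall m, mdeg m <= mdeg k}%N ->
  (k <= c)%MM ->
  exists b : 'X_{1..n}, [/\ (b <= c)%MM, (c <= b + k)%MM &
    \sum_(m <- s) g m * \prod_(i < n) (b i ^_ m i)%:R != 0].
Proof.
move=> small s_uniq ks gk_neq0 s_deg /mnm_lepP kc.
pose A i := [seq (c i - j)%:R : F | j <- iota 0 (k i).+1].
have A_uniq i : uniq (A i).
  rewrite map_inj_in_uniq ?iota_uniq // => j1 j2.
  rewrite !mem_iota !add0n !ltnS /=.
  wlog j12 : j1 j2 / (j1 <= j2)%N => [hw|] j1k j2k cj.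
    by have [j12|/ltnW j21] := leqP j1 j2; [|apply/esym]; apply: hw.
  apply/eqP; rewrite eqn_leq j12 leqNgt; apply/negP => j12'.
  have ki : (k i <= mdeg k)%N by rewrite mdegE (bigD1 i) //= leq_addr.
  have kci := kc i.
  have /negP[] : (j2 - j1)%:R != 0 :> F by apply: small; lia.
  have -> : (j2 - j1 = (c i - j1) - (c i - j2))%N by lia.
  by rewrite natrB ?subr_eq0 ?cj //; lia.
have [i|x xA x_neq0] := @grid_nonvanishing F n (falling_poly F) A s g k
  (@falling_poly_monic F) (@size_falling_poly F) A_uniq _ s_uniq ks gk_neq0 s_deg.
  by rewrite size_map size_iota.
have /fin_all_exists[b bP] : forall i, exists bi, [/\ bi <= c i, c i <= bi + k i
    & x i = bi%:R]%N.
  move=> i; have /mapP[j] := xA i; rewrite mem_iota add0n ltnS => jk ->.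
  by exists (c i - j)%N; have := kc i; split=> //; lia.
exists [multinom b i | i < n]; split.
- by apply/mnm_lepP => i; rewrite mnmE; case: (bP i).
- by apply/mnm_lepP => i; rewrite mnmDE mnmE; case: (bP i).
move: x_neq0; congr (_ != 0); apply: eq_bigr => m _; congr (_ * _).
by apply: eq_bigr => i _; rewrite mnmE; case: (bP i) => _ _ ->;
  rewrite horner_falling_poly.
Qed.

Lemma natr_fact_neq0 (R : idomainType) (N : nat) :
  (forall t, (0 < t <= N)%N -> t%:R != 0 :> R) -> N`!%:R != 0 :> R.
Proof.
elim: N => [|N IHN] small; first by rewrite oner_neq0.
rewrite factS natrM mulf_neq0 //; first by apply: small; rewrite leqnn.
by apply: IHN => t /andP[t0 tN]; rewrite small // t0 ltnW.
Qed.

(** The exponent [b] is found in the box between [c - k] and [c], whence the two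
    bounds on its degree; [N] is at most [mdeg c - mdeg k], so that [N!] is not
    zero in [F].  The exponents [b_i] may exceed the characteristic, but this
    does no harm: the factorials [b_i!] multiply the coefficient whose
    nonvanishing is to be proved. *)
Lemma mcoeff_linear_formX_neq0 (F : fieldType) (n : nat) (a : 'I_n -> F)
    (Q : {mpoly F[n]}) (k c : 'X_{1..n}) :
  (forall i, a i != 0) -> Q \is (mdeg k).-homog -> Q@_k != 0 ->
  (k <= c)%MM -> (mdeg k + mdeg k <= mdeg c)%N ->
  (forall t, (0 < t <= mdeg c - mdeg k)%N -> t%:R != 0 :> F) ->
  exists b : 'X_{1..n}, exists N : nat,
    [/\ (b <= c)%MM, mdeg b = (mdeg k + N)%N, (mdeg c <= mdeg k + mdeg k + N)%N
      & (Q * linear_form a ^+ N)@_b != 0].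
Proof.
move=> a_neq0 Q_homog Qk_neq0 kc deg_c small.
(* Of the factors [a_i^(b_i - m_i)], only [a_i^(-m_i)] depends on [m]. *)
pose g (m : 'X_{1..n}) := Q@_m * \prod_i a i ^- m i.
have [t /andP[t0 tk]||||b [bc cb b_neq0]] :=
    @falling_nonvanishing F n g (msupp Q) k c _ (msupp_uniq Q) _ _ _ kc.
- by apply: small; lia.
- by rewrite mcoeff_msupp.
- rewrite mulf_neq0 //; apply/prodf_neq0 => i _.
  by rewrite invr_eq0 expf_neq0.
- by move=> m mQ; rewrite (dhomogP _ _ _ Q_homog).
have deg_b : (mdeg c <= mdeg b + mdeg k)%N.
  by rewrite -mdegD !mdegE leq_sum // => i _; apply/mnm_lepP.
have deg_bc : (mdeg b <= mdeg c)%N.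
  by rewrite !mdegE leq_sum // => i _; apply/mnm_lepP.
pose N := (mdeg b - mdeg k)%N.
have bN : mdeg b = (mdeg k + N)%N by rewrite /N; lia.
exists b, N; split=> //; first by rewrite /N; lia.
have := fact_mcoeff_mul_linear_formX a Q_homog bN.
have -> : \sum_(m <- msupp Q)
    Q@_m * \prod_(i < n) (a i ^+ (b i - m i) * (b i ^_ m i)%:R)
  = (\prod_(i < n) a i ^+ b i) * \sum_(m <- msupp Q)
    g m * \prod_(i < n) (b i ^_ m i)%:R.
  rewrite mulr_sumr; apply: eq_bigr => m _; rewrite /g mulrCA -mulrA.
  congr (_ * _); rewrite -!big_split /=; apply: eq_bigr => i _.
  have [mb|bm] := leqP (m i) (b i); last by rewrite ffact_small // !mulr0.
  by rewrite mulrCA mulrA expfB_cond // (negPf (a_neq0 i)).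
move=> fact_eq; apply/negP => /eqP Q0.
move: fact_eq; rewrite Q0 mulr0 => /esym/eqP.
rewrite !mulf_eq0 (negPf b_neq0) orbF; apply/negP; rewrite negb_or.
apply/andP; split.
  by apply: natr_fact_neq0 => t /andP[t0 tN]; apply: small; lia.
by apply/prodf_neq0 => i _; rewrite expf_neq0.
Qed.

(** * Restricted sums and the Combinatorial Nullstellensatz *)

Lemma combinatorial_nullstellensatz (R : idomainType) (n : nat)
    (A : 'I_n -> seq R) (f : {mpoly R[n]}) (b : 'X_{1..n}) :
  (forall i, uniq (A i)) -> (forall i, b i < size (A i))%N ->
  (msize f <= (mdeg b).+1)%N -> f@_b != 0 ->
  exists2 x : 'I_n -> R, (forall i, x i \in A i) & f.@[x] != 0.
Proof.
move=> A_uniq bA sf fb.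
have [d|d||m mf|x xA x0] := @grid_nonvanishing R n (fun d => 'X^d) A (msupp f)
    (fun m => f@_m) b _ _ A_uniq bA (msupp_uniq f) _ fb.
- exact: monicXn.
- by rewrite size_polyXn.
- by rewrite mcoeff_msupp.
- by rewrite -ltnS (leq_trans (msize_mdeg_lt mf)).
exists x => //; move: x0; congr (_ != 0); rewrite mevalE; apply: eq_bigr => m _.
by congr (_ * _); apply: eq_bigr => i _; rewrite hornerXn.
Qed.

(** This is the lower bound
    [|C| >= min (p - d, \sum (|A_i| - 1) - 2 d + 1)], where [d = mdeg k] and [p] is
    the additive order of [1]: the last two hypotheses say that [e] does not
    exceed either term.  Stating it for every such [e] covers the case of an
    infinite [p], and needs no subtraction.

    The set of admissible top exponents is first cut down from [|A_i| - 1] to [c]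
    with [mdeg c = e - 1 + 2 d], which keeps the exponent [N] of the linear form
    between [e - 1] and [e - 1 + d], hence below [p]. *)
Theorem restricted_linear_sum_bound (F : fieldType) (n : nat) (a : 'I_n -> F)
    (A : 'I_n -> seq F) (P : {mpoly F[n]}) (k : 'X_{1..n}) (C : seq F)
    (e : nat) :
  (forall i, a i != 0) -> (forall i, uniq (A i)) ->
  (forall i, k i < size (A i))%N -> (msize P <= (mdeg k).+1)%N -> P@_k != 0 ->
  (forall x, (forall i, x i \in A i) -> P.@[x] != 0 ->
     \sum_(i < n) a i * x i \in C) ->
  (forall t, (0 < t < e + mdeg k)%N -> t%:R != 0 :> F) ->
  (e + 2 * mdeg k <= \sum_(i < n) (size (A i)).-1 + 1)%N ->
  (e <= size C)%N.
Proof.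
move=> a_neq0 A_uniq kA sP Pk_neq0 sumC small le_e.
rewrite leqNgt; apply/negP => Ce.
set d := mdeg k in sP small le_e.
pose t := [multinom (size (A i)).-1 | i < n].
have deg_t : mdeg t = (\sum_(i < n) (size (A i)).-1)%N.
  by rewrite mdegE; apply: eq_bigr => i _; rewrite mnmE.
have kt : (k <= t)%MM.
  by apply/mnm_lepP => i; rewrite mnmE; have := kA i; case: (size _).
have [|c [kc ct deg_c]] := mnm_between (D := (e.-1 + 2 * d)%N) kt.
  by rewrite deg_t -/d; lia.
have PQ := same_top_pihomog sP.
have [|||||b [N [bc deg_b deg_N b_neq0]]] :=
    @mcoeff_linear_formX_neq0 _ _ a (pihomog mdeg d P) k c a_neq0.
- exact: pihomogP.
- by rewrite -(same_top_mcoeff PQ).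
- exact: kc.
- by rewrite deg_c -/d; lia.
- by rewrite deg_c -/d => s s_le; apply: small; lia.
rewrite -/d in deg_b deg_N.
pose L := linear_form a.
have sL : (msize L <= 2)%N := msize_linear_form a.
(* Since [size C < e <= N + 1], all the values in [C] can be made zeros of a
   polynomial with the same top part as [P * L ^+ N]. *)
pose f := P * ((\prod_(y <- C) (L - y%:MP)) * L ^+ (N - size C)).
have f_top : same_top (mdeg b) f (pihomog mdeg d P * L ^+ N).
  have CN : (size C <= N)%N by lia.
  rewrite deg_b; apply: same_topM => //.
  rewrite -{1 3}(subnKC CN) exprD; apply: same_topM; last first.
    by rewrite -[X in same_top X]muln1; apply/same_topX/same_top_refl.
  have := @same_top_prod F n _ C predT (fun _ => 1%N) (fun y => L - y%:MP)
    (fun _ => L) (fun y _ => same_top_subC y sL).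
  by rewrite sum1_size big_const_seq count_predT iter_mulr_1.
have [| | |x xA fx_neq0] := @combinatorial_nullstellensatz F n A f b A_uniq.
- move=> i; have /mnm_lepP/(_ i) := lepm_trans bc ct.
  by rewrite mnmE; have := kA i; case: (size _).
- by case: f_top.
- by rewrite (same_top_mcoeff f_top).
move: fx_neq0; rewrite /f !mevalM mulf_eq0 negb_or => /andP[Px_neq0].
rewrite mulf_eq0 negb_or => /andP[+ _].
have yC := sumC x xA Px_neq0.
rewrite rmorph_prod (perm_big _ (perm_to_rem yC)) big_cons mulf_eq0 negb_or.
move=> /andP[/eqP[]].
rewrite rmorphB /= mevalC /L /linear_form raddf_sum /=.
apply/eqP; rewrite subr_eq0; apply/eqP/eq_bigr => i _.
by rewrite mevalZ mevalXU.
Qed.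

(** * Dyson's constant term identity *)

(** A monomial without [x_i] does not see multiples of [x_i]. *)
Lemma mcoeffM_mod_var (R : comNzRingType) (n : nat) (i : 'I_n) (m : 'X_{1..n})
    (p q r h : {mpoly R[n]}) :
  m i = 0%N -> p = q + h * 'X_i -> (p * r)@_m = (q * r)@_m.
Proof.
move=> mi ->; rewrite mulrDl mulrAC mcoeffD mcoeff_mulXm lep1mP mi eqxx.
by rewrite addr0.
Qed.

Lemma prod_exp_sub_mod_var (R : comNzRingType) (n : nat) (i : 'I_n)
    (K : {set 'I_n}) (a : 'I_n -> nat) :
  exists h : {mpoly R[n]},
    \prod_(j in K) ('X_j - 'X_i) ^+ a j = \prod_(j in K) 'X_j ^+ a j + h * 'X_i.
Proof.
elim/big_rec2: _ => [|j p q _ [h ->]]; first by exists 0; rewrite mul0r addr0.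
have [g ->] : exists g : {mpoly R[n]},
    ('X_j - 'X_i) ^+ a j = 'X_j ^+ a j + g * 'X_i.
  exists (- \sum_(l < a j) ('X_j - 'X_i) ^+ ((a j).-1 - l) * 'X_j ^+ l).
  have /eqP := subrXX ('X_j - 'X_i) ('X_j : {mpoly R[n]}) (a j).
  by rewrite subr_eq => /eqP ->; set u := \sum_(l < _) _; ring.
by exists ('X_j ^+ a j * h + g * p + g * h * 'X_i); ring.
Qed.

(** Dividing by the monomial of exponent [dyson_mnm J a] turns this into Dyson's
    product of the [(1 - x_j / x_i)^(a_i)].  The set of variables is a parameter
    because the recursion discards those with exponent zero. *)
Definition dyson_poly (R : comNzRingType) (n : nat) (J : {set 'I_n})
    (a : 'I_n -> nat) : {mpoly R[n]} :=
  \prod_(i in J) (\prod_(j in J :\ i) ('X_i - 'X_j)) ^+ a i.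

Definition dyson_mnm (n : nat) (J : {set 'I_n}) (a : 'I_n -> nat) : 'X_{1..n} :=
  [multinom if i \in J then (#|J|.-1 * a i)%N else 0%N | i < n].

Definition lower (n : nat) (a : 'I_n -> nat) (i : 'I_n) : 'I_n -> nat :=
  fun j => (a j - (j == i))%N.

(** The exponent of [x_i] in the monomial is zero, so one may put [x_i = 0]; this
    turns the factors [(x_j - x_i)^(a_j)] into the powers [x_j^(a_j)] by which the
    two monomials differ. *)
Lemma dyson_mcoeff_drop (R : comNzRingType) (n : nat) (J : {set 'I_n})
    (a : 'I_n -> nat) (i : 'I_n) :
  i \in J -> a i = 0%N ->
  (dyson_poly R J a)@_(dyson_mnm J a)
  = (dyson_poly R (J :\ i) a)@_(dyson_mnm (J :\ i) a).
Proof.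
move=> iJ ai0; set K := J :\ i.
have -> : dyson_poly R J a
    = (\prod_(j in K) ('X_j - 'X_i) ^+ a j) * dyson_poly R K a.
  rewrite /dyson_poly (big_setD1 i) //= ai0 expr0 mul1r -big_split /=.
  apply: eq_bigr => j; rewrite !inE => /andP[ji jJ].
  rewrite -exprMn (big_setD1 i) /=; last by rewrite !inE eq_sym ji.
  by rewrite /K !setDDl setUC.
have [h hE] := prod_exp_sub_mod_var R i K a.
rewrite (mcoeffM_mod_var _ _ hE); last by rewrite mnmE ai0 muln0 if_same.
pose u := [multinom if j \in K then a j else 0%N | j < n].
have -> : \prod_(j in K) 'X_j ^+ a j = 'X_[R, u].
  rewrite mpolyXE_id big_mkcond; apply: eq_bigr => j _.
  by rewrite mnmE; case: ifP.
have -> : dyson_mnm J a = (u + dyson_mnm K a)%MM.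
  apply/mnmP => j; rewrite mnmDE !mnmE.
  case: (boolP (j \in K)) => [jK|].
    have := jK; rewrite {1}/K !inE => /andP[_ ->].
    by rewrite [#|J|](cardsD1 i) iJ -/K [#|K|](cardsD1 j) jK.
  rewrite !inE negb_and negbK => /orP[/eqP->|/negPf->] //.
  by rewrite ai0 iJ muln0.
by rewrite mulrC mcoeffMX.
Qed.

(** Good's recursion: multiply the interpolation of [t^(|J|-1)] at the variables,
    namely [\sum_i x_i^(|J|-1) / \prod_(j != i) (x_i - x_j) = 1], by the whole
    product. *)
Lemma dyson_poly_rec (R : idomainType) (n : nat) (J : {set 'I_n})
    (a : 'I_n -> nat) :
  (0 < #|J|)%N -> {in J, forall i, 0 < a i}%N ->
  dyson_poly R J a = \sum_(i in J) dyson_poly R J (lower a i) * 'X_i ^+ #|J|.-1.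
Proof.
move=> J_gt0 a_gt0.
have X_inj : {in J &, injective (fun i : 'I_n => 'X_i : {mpoly R[n]})}.
  move=> i j _ _ /(congr1 (fun p => p@_U_(j))) /eqP.
  rewrite !mcoeffXU eqxx; case: (eqVneq i j) => // _.
  by rewrite eq_sym (oner_eq0 R).
have /= := lagrange_lead_coef (q := 'X^(#|J|.-1)) X_inj.
rewrite size_polyXn prednK // coefXn eqxx mul1r => /(_ (leqnn _)) lagr.
pose f i : {mpoly R[n]} := \prod_(j in J :\ i) ('X_i - 'X_j).
pose G := \prod_(i in J) f i ^+ (a i).-1.
have -> : dyson_poly R J a = (\prod_(i in J) f i) * G.
  rewrite -big_split /=; apply: eq_bigr => i iJ.
  by rewrite -exprS prednK ?a_gt0.
rewrite -lagr mulr_suml; apply: eq_bigr => i iJ; rewrite hornerXn.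
have -> : dyson_poly R J (lower a i) = (\prod_(k in J :\ i) f k) * G.
  rewrite /dyson_poly /G !(big_setD1 i iJ) /= /lower eqxx subn1 mulrCA.
  congr (_ * _); rewrite -big_split /=; apply: eq_bigr => j.
  rewrite !inE => /andP[/negPf-> jJ].
  by rewrite subn0 -exprS prednK ?a_gt0.
by rewrite -mulrA mulrC.
Qed.

(** Good's proof: both sides satisfy the recursion [f a = \sum_i a_i f (a - e_i)],
    and reduce to fewer variables when some [a_i] is zero.  The factorials are
    kept on the left so that the identity holds in every characteristic. *)
Theorem dyson_mcoeff (R : idomainType) (n : nat) (J : {set 'I_n})
    (a : 'I_n -> nat) :
  (\prod_(i in J) (a i)`!)%:R * (dyson_poly R J a)@_(dyson_mnm J a)
  = (\sum_(i in J) a i)`!%:R.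
Proof.
have [m le_m] := ubnP (#|J| + \sum_(i in J) a i)%N.
elim: m J a le_m => // m IHm J a; rewrite ltnS => le_m.
have [J0|J_gt0] := posnP #|J|.
  have -> : dyson_mnm J a = 0%MM.
    by apply/mnmP => i; rewrite mnmE mnm0E (cards0_eq J0) inE.
  by rewrite /dyson_poly (cards0_eq J0) !big_set0 mcoeff1 eqxx mulr1.
have [/exists_inP[i iJ /eqP ai0]|/exists_inPn a_neq0] :=
    boolP [exists i in J, a i == 0%N].
  rewrite (dyson_mcoeff_drop R iJ ai0) !(big_setD1 i iJ) /= ai0 mul1n add0n.
  apply: IHm; apply: leq_trans le_m.
  by rewrite [#|J|](cardsD1 i) iJ (big_setD1 i iJ) /= ai0 add0n.
have a_gt0 : {in J, forall i, 0 < a i}%N by move=> i /a_neq0; rewrite lt0n.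
have sum_lower i : i \in J ->
    (\sum_(j in J) a j = (\sum_(j in J) lower a i j).+1)%N.
  move=> iJ; rewrite !(big_setD1 i iJ) /= /lower eqxx.
  rewrite -addSn subn1 prednK ?a_gt0 //; congr (_ + _)%N.
  by apply: eq_bigr => j; rewrite !inE => /andP[/negPf-> _]; rewrite subn0.
rewrite dyson_poly_rec // raddf_sum /= mulr_sumr.
have [i0 i0J] : exists i0, i0 \in J by apply/card_gt0P.
set s := (\sum_(i in J) a i)%N.
have s_gt0 : (0 < s)%N by rewrite /s (sum_lower i0).
transitivity (\sum_(i in J) (a i)%:R * (s.-1)`!%:R : R); last first.
  by rewrite -mulr_suml -natr_sum -natrM -/s -{1}(prednK s_gt0) -factS prednK.
apply: eq_bigr => i iJ.
have -> : (\prod_(j in J) (a j)`! = a i * \prod_(j in J) (lower a i j)`!)%N.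
  rewrite !(big_setD1 i iJ) /= /lower eqxx -{1}(prednK (a_gt0 i iJ)) factS.
  rewrite prednK ?a_gt0 // subn1 mulnA; congr (_ * _)%N.
  by apply: eq_bigr => j; rewrite !inE => /andP[/negPf-> _]; rewrite subn0.
have -> : dyson_mnm J a = (U_(i) *+ #|J|.-1 + dyson_mnm J (lower a i))%MM.
  apply/mnmP => j; rewrite mnmDE mulmnE mnm1E !mnmE /lower [j == i]eq_sym.
  case: eqVneq => [<-|_]; last by rewrite subn0.
  by rewrite iJ mul1n -mulnS subn1 prednK ?a_gt0.
have sE : s = (\sum_(j in J) lower a i j).+1 := sum_lower i iJ.
rewrite mpolyXn mcoeffMX natrM -mulrA IHm ?sE //.
by apply: leq_trans le_m; rewrite -/s sE addnS.
Qed.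

(** * Sums with restricted differences *)

(** The bounds [mu i] need not be attained: the missing factors are supplied by
    powers of [x_i - x_j].  They exclude more points, which only makes the
    sumset smaller, and they give the top part of [P] the shape of Dyson's
    product. *)
Lemma restricted_sumset_bound (F : fieldType) (n : nat)
    (a : 'I_n -> F) (A : 'I_n -> {fset F}) (S : 'I_n -> 'I_n -> {fset F})
    (mu : 'I_n -> nat) (e : nat) :
  (1 < n)%N ->
  (forall i, a i != 0) ->
  (forall i j, i != j -> #|` S i j| <= mu i)%N ->
  (forall i, n.-1 * mu i < #|` A i|)%N ->
  (forall t, (0 < t < e + n.-1 * \sum_(i < n) mu i)%N -> t%:R != 0 :> F) ->
  (e + 2 * (n.-1 * \sum_(i < n) mu i) <= \sum_(i < n) (#|` A i|).-1 + 1)%N ->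
  (e <= #|` restricted_sumset a A S|)%N.
Proof.
move=> n_gt1 a_neq0 S_le mu_lt small le_e.
have [->//|e_gt0] := posnP e.
pose k := dyson_mnm [set: 'I_n] mu.
have kE i : k i = (n.-1 * mu i)%N by rewrite mnmE inE cardsT card_ord.
have deg_k : mdeg k = (n.-1 * \sum_(i < n) mu i)%N.
  by rewrite mdegE big_distrr; apply: eq_bigr => i _; rewrite kE.
pose lin (i j : 'I_n) : {mpoly F[n]} := 'X_i - 'X_j.
have s_lin i j : (msize (lin i j) <= 2)%N.
  by rewrite (leq_trans (mmeasureD_le _ _ _)) // mmeasureN !msizeX !mdeg1.
pose P := \prod_(i in [set: 'I_n]) \prod_(j in [set: 'I_n] :\ i)
  (lin i j ^+ (mu i - #|` S i j|) * \prod_(y <- S i j) (lin i j - y%:MP)).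
have P_top : same_top (mdeg k) P (dyson_poly F [set: 'I_n] mu).
  have -> : mdeg k
      = (\sum_(i in [set: 'I_n]) \sum_(j in [set: 'I_n] :\ i) mu i)%N.
    rewrite deg_k big_distrr; apply: eq_big => i; first by rewrite inE.
    move=> _; rewrite sum_nat_const; congr (_ * _)%N.
    by have /(congr1 predn) := cardsD1 i [set: 'I_n]; rewrite cardsT card_ord inE.
  apply: same_top_prod => i _; rewrite -prodrXl.
  apply: same_top_prod => j; rewrite !inE eq_sym andbT => ij.
  rewrite -{1 3}(subnK (S_le i j ij)) exprD; apply: same_topM.
    by rewrite -[X in same_top X]muln1; apply/same_topX/same_top_refl.
  have := @same_top_prod F n _ (S i j) predT (fun _ => 1%N)
    (fun y => lin i j - y%:MP) (fun _ => lin i j)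
    (fun y _ => same_top_subC y (s_lin i j)).
  by rewrite sum1_size big_const_seq count_predT iter_mulr_1.
have Pk_neq0 : P@_k != 0.
  rewrite (same_top_mcoeff P_top erefl); apply/eqP => D0.
  have := @dyson_mcoeff F n [set: 'I_n] mu; rewrite D0 mulr0 => /esym/eqP.
  apply/negP/natr_fact_neq0 => t /andP[t_gt0 t_le]; apply: small.
  rewrite t_gt0 (leq_ltn_trans t_le) //.
  under eq_bigl do rewrite inE.
  by rewrite -[X in (X < _)%N]add0n -addSn leq_add // leq_pmull //; lia.
have := @restricted_linear_sum_bound F n a (fun i => A i) P k
  (restricted_sumset a A S) e a_neq0 _ _ _ Pk_neq0.
rewrite deg_k; apply=> // [i|i||x xA Px_neq0].
- exact: fset_uniq.
- by rewrite kE.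
- by rewrite -deg_k; case: P_top.
apply/restricted_sumsetP; exists x; split=> // i j ij.
apply: contraNN Px_neq0 => xS.
rewrite /P rmorph_prod; apply/prodf_eq0; exists i; rewrite ?inE //.
rewrite rmorph_prod; apply/prodf_eq0; exists j; rewrite ?inE 1?eq_sym ?ij //=.
rewrite mevalM (rmorph_prod (meval x)) (big_rem _ xS) /= mevalB mevalC /lin.
by rewrite mevalB !mevalXU subrr mul0r mulr0.
Qed.

End Coefficients.

From mathcomp Require Import boolp constructive_ereal.

Local Open Scope fset_scope.

Lemma natr_neq0_lt_one_order (F : fieldType) (t : nat) :
  (0 < t)%N -> (t%:Z%:E < one_order F)%E -> t%:R != 0 :> F.
Proof.
move=> t_gt0; rewrite /one_order; case: pselect => [ex_k|no_k] /=.
  case: ex_minnP => k _ kmin; rewrite lte_fin ltz_nat ltnNge.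
  by apply: contraNN => t0; rewrite kmin ?t_gt0.
by move=> _; apply/negP => t0; apply: no_k; exists t; rewrite t_gt0.
Qed.

Theorem corollary1p3 (F : fieldType) (n : nat) (n_gt1 : (1 < n)%N)
    (A : 'I_n -> {fset F}) (A_neq0 : forall i : 'I_n, A i != fset0)
    (S : 'I_n -> 'I_n -> {fset F})
    (S_le : forall i j : 'I_n, i != j ->
       (#|` S i j|)%:R <= ((#|` A i|)%:R - 1) / (n%:R - 1) :> rat)
    (a : 'I_n -> F) (a_neq0 : forall i : 'I_n, a i != 0) :
  (Order.min
     (one_order F - ((n%:Z - 1) * \sum_(i < n) (max_excluded S i)%:Z)%R%:E)
     (\sum_(i < n) ((#|` A i|)%:Z - 1)
        - 2 * (n%:Z - 1) * \sum_(i < n) (max_excluded S i)%:Z + 1)%R%:E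
   <= ((#|` restricted_sumset a A S|)%:Z)%:E)%E.
Proof.
have n1_gt0 : (0 < n.-1)%N by lia.
have A_gt0 i : (0 < #|` A i|)%N by rewrite cardfs_gt0.
have n1E : n%:Z - 1 = n.-1%:Z by lia.
have sumAE : \sum_(i < n) ((#|` A i|)%:Z - 1)
    = (\sum_(i < n) (#|` A i|).-1)%N%:Z.
  rewrite (big_morph Posz PoszD (erefl 0%:Z)); apply: eq_bigr => i _.
  by rewrite -[1]/(1%:Z) subzn // subn1.
have sumME : \sum_(i < n) (max_excluded S i)%:Z
    = (\sum_(i < n) max_excluded S i)%N%:Z.
  by rewrite (big_morph Posz PoszD (erefl 0%:Z)).
have max_lt i : (n.-1 * max_excluded S i < #|` A i|)%N.
  rewrite -[X in (_ < X)%N](prednK (A_gt0 i)) ltnS mulnC -leq_divRL //.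
  apply/bigmax_leqP => j ji; rewrite leq_divRL //.
  have := S_le i j; rewrite eq_sym => /(_ ji).
  have -> : n%:R - 1 = n.-1%:R :> rat.
    by rewrite -{1}(prednK (ltnW n_gt1)) mulrSr addrK.
  rewrite ler_pdivlMr ?ltr0n // -{1}(prednK (A_gt0 i)) mulrSr addrK.
  by rewrite -natrM ler_nat.
have S_max i j : i != j -> (#|` S i j| <= max_excluded S i)%N.
  by move=> ij; apply: leq_bigmax_cond; rewrite eq_sym.
rewrite n1E sumAE sumME.
set c := #|` restricted_sumset a A S|.
set D := (\sum_(i < n) max_excluded S i)%N.
rewrite leNgt; apply/negP; rewrite lt_min lte_fin => /andP[c_lt1 c_lt2].
(* If the bound failed, [c.+1] would be below both terms of the minimum. *)
suff : (c.+1 <= c)%N by rewrite ltnn.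
apply: (@restricted_sumset_bound F n a A S (max_excluded S)) => //.
  move=> t /andP[t_gt0 t_lt]; apply: natr_neq0_lt_one_order => //.
  move: c_lt1; rewrite lteBrDr // -EFinD; apply: le_lt_trans.
  by rewrite lee_fin; lia.
rewrite -/D; lia.
Qed.
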